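(* Let $n$ be a positive integer with $n\equiv 4,12,20,28,44$ or $52 \pmod{56}$. Then there exists a configuration $(2,4)$ $GDD\left(n,2,6;\frac{7n}{4},2(n-1)\right)$.
   Context: A $GDD(n,2,6;\lambda_1,\lambda_2)$ is a finite collection (repetitions allowed) of $6$-element subsets, called blocks, of a $2n$-element set $X$ partitioned into two groups of size $n$, such that every point lies in the same number $r$ of blocks, any two distinct points of the same group lie together in exactly $\lambda_1$ blocks, and any two points from different groups lie together in exactly $\lambda_2$ blocks. It has configuration $(2,4)$ if every block has exactly $2$ points in one of the two groups and $4$ points in the other (which group contains the $2$ points may depend on the block). *)

(* Defs.v *)
From mathcomp Require Import all_boot.

Set Implicit Arguments.
Unset Strict Implicit.
Unset Printing Implicit Defensive.

Section GroupDivisibleDesign.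

Variable X : finType.

(* The collection of blocks is a list, so that blocks may be repeated; its
   order is never used. *)
Definition replication (blocks : seq {set X}) (x : X) : nat :=
  count (fun B : {set X} => x \in B) blocks.

Definition concurrence (blocks : seq {set X}) (x y : X) : nat :=
  count (fun B : {set X} => (x \in B) && (y \in B)) blocks.

(* GDD(n, m, k; lambda1, lambda2) with point set X. *)
Record is_GDD (n m k lambda1 lambda2 : nat)
    (groups : {set {set X}}) (blocks : seq {set X}) : Prop := IsGDD {
  GDD_points : #|X| = m * n;
  GDD_partition : partition groups [set: X];
  GDD_num_groups : #|groups| = m;
  GDD_group_size : forall G, G \in groups -> #|G| = n;
  GDD_block_size : forall B, B \in blocks -> #|B| = k;
  GDD_replication : exists r, forall x, replication blocks x = r;
  GDD_same_group : forall G x y, G \in groups -> x \in G -> y \in G ->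
    x != y -> concurrence blocks x y = lambda1;
  GDD_diff_group : forall G H x y, G \in groups -> H \in groups -> G != H ->
    x \in G -> y \in H -> concurrence blocks x y = lambda2
}.

(* Configuration (s, t); meaningful when there are exactly two groups. *)
Definition has_configuration (s t : nat)
    (groups : {set {set X}}) (blocks : seq {set X}) : Prop :=
  forall B, B \in blocks ->
    exists G H, [/\ G \in groups, H \in groups, G != H,
                    #|B :&: G| = s & #|B :&: H| = t].

End GroupDivisibleDesign.

(* Main.v *)
Require Import Defs.
From HB Require Import structures.
From mathcomp Require Import all_boot all_fingroup all_algebra cyclic.
From mathcomp Require Import zify.

(* Write n = 4m with m odd.  Take a 2-(n,4,3) design on each of the two groups,
   and a one-factorization of the complete graph on the other group.  Attach a
   one-factor to each block of the design, each of the n-1 factors being used m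
   times, and form all unions of a block with an edge of its factor.  Since a
   one-factor covers every point exactly once, any such assignment works: two
   points of a group lie together 3 (n/2) + m = 7n/4 times, and two points of
   different groups (n-1) + (n-1) times.

   For the 2-(n,4,3) design take the points V x L, where V is an abelian group of
   odd order and L has 4 or 12 levels, with a 2-(|L|,4,3) design on each fibre,
   and an odd map phi such that phi, phi+1, phi-1 and doubling are injective.  For d
   in a half of V \ {0} and a word (a,b,c,e) over L, the block
   {(x+d,a), (x-d,b), (x+phi d,c), (x-phi d,e)} has all its first-coordinate
   differences running bijectively with d.  If the words are closed under
   (a,b,c,e) -> (b,a,e,c) and every ordered pair of levels occurs 6 times in them,
   each pair of points in different fibres is covered 3 times.  Suitable V exist
   for all odd orders except those divisible by 3 exactly once, which are handled by
   the 12 levels. *)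

Set Implicit Arguments.
Unset Strict Implicit.
Unset Printing Implicit Defensive.

(** * Balanced designs *)

Definition is_BIBD (T : finType) (k lambda : nat) (s : seq {set T}) :=
  (forall B, B \in s -> #|B| = k) /\
  (forall x y, x != y -> concurrence s x y = lambda).

Lemma replicationE (T : finType) (s : seq {set T}) x :
  replication s x = \sum_(B <- s) (x \in B).
Proof. by rewrite /replication -sum1_count big_mkcond; apply: eq_bigr => B _; case: (_ \in _). Qed.

Lemma concurrenceE (T : finType) (s : seq {set T}) x y :
  concurrence s x y = \sum_(B <- s) (x \in B) * (y \in B).
Proof.
rewrite /concurrence -sum1_count big_mkcond; apply: eq_bigr => B _.
by case: (x \in B); case: (y \in B).
Qed.

Lemma sum_mem_card (T : finType) (A : {pred T}) : \sum_(x : T) (x \in A) = #|A|.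
Proof. by rewrite -sum1_card [RHS]big_mkcond; apply: eq_bigr => x _; case: ifP. Qed.

Lemma sum_eq1 (T : finType) (a : T) (P : pred T) : \sum_(x | P x) (x == a : nat) = P a.
Proof.
case: (boolP (P a)) => Pa.
  rewrite (bigD1 a) //= eqxx big1 // => x /andP[_ /negPf ->] //.
by rewrite big1 // => x Px; case: eqP => // xa; rewrite -xa Px in Pa.
Qed.

(** Double counting of the pairs [(y, B)] with [y != x] and both points in [B]: each [y] occurs in
    [lambda] of them, each block through [x] in [k.-1]. *)
Lemma BIBD_replication (T : finType) k lambda (s : seq {set T}) x :
  is_BIBD k lambda s -> replication s x * k.-1 = lambda * #|T|.-1.
Proof.
case=> card_s conc_s.
have <- : \sum_(y | y != x) concurrence s x y = lambda * #|T|.-1.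
  rewrite (eq_bigr (fun=> lambda)) => [|y y_x]; last by rewrite conc_s // eq_sym.
  by rewrite sum_nat_const mulnC -(cardC1 x).
rewrite (eq_bigr _ (fun y _ => concurrenceE s x y)) exchange_big /=.
rewrite replicationE big_distrl /= !big_seq; apply: eq_bigr => B /card_s card_B.
rewrite -big_distrr /=; case: (boolP (x \in B)) => // xB; rewrite !mul1n.
rewrite -card_B -sum_mem_card [in LHS](bigD1 x) //= xB; lia.
Qed.

Lemma sum_replication (T : finType) k (s : seq {set T}) :
  (forall B, B \in s -> #|B| = k) -> \sum_x replication s x = size s * k.
Proof.
move=> card_s; rewrite (eq_bigr _ (fun x _ => replicationE s x)) exchange_big /=.
rewrite big_seq (eq_bigr (fun=> k)) => [|B /card_s <-]; last exact: sum_mem_card.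
by rewrite -big_seq big_const_seq count_predT iter_addn_0 mulnC.
Qed.

(** * One-factorizations *)

(* [mate k] is the k-th one-factor of the complete graph on T, seen as a
   fixed-point-free involution; [c x y] is the factor containing {x, y}. *)
Definition one_factorization (T C : finType) (mate : C -> T -> T) (c : T -> T -> C) :=
  [/\ forall k, involutive (mate k), forall k x, mate k x != x &
      forall k x y, x != y -> (mate k x == y) = (k == c x y)].

Section RoundRobin.
Variable C : finZmodType.
Hypothesis dbl_inj : injective (fun a : C => (a + a)%R).
Import GRing.Theory.
Local Open Scope ring_scope.

(** The round-robin tournament: the points are the group and a point [None] at infinity. Factor [k]
    joins [a] to [k - a]; the one [a] with [a + a = k], which would be its own mate, is joined to
    infinity. *)
Definition robin_mate (k : C) (x : option C) : option C :=
  match x with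
  | None => Some (invF dbl_inj k)
  | Some a => if a + a == k then None else Some (k - a)
  end.

Definition robin_color (x y : option C) : C :=
  match x, y with
  | Some a, Some b => a + b
  | Some a, None | None, Some a => a + a
  | None, None => 0
  end.

Lemma robin_one_factorization : one_factorization robin_mate robin_color.
Proof.
have half k a : (invF dbl_inj k == a) = (k == a + a).
  by rewrite -(inj_eq dbl_inj) (f_invF dbl_inj).
split=> [k [a|]|k [a|]|k [a|] [b|]] //=.
- case: eqP => [<-|/eqP ne] /=; first by congr Some; apply: (invF_f dbl_inj).
  rewrite ifN ?subKr //; apply: contra ne => /eqP e.
  have e' : k - a = a by apply: (addrI (k - a)); rewrite e subrK.
  by rewrite -{1}e' subrK.
- by rewrite (f_invF dbl_inj) eqxx.
- by case: (a + a =P k) => // ne; apply/eqP => -[e]; case: ne; rewrite -{1}e subrK.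
- move=> ab; have {}ab : a != b by apply: contraNneq ab => ->.
  case: (a + a =P k) => [<-|_]; last by rewrite -[LHS]/(k - a == b) subr_eq addrC.
  by rewrite (inj_eq (addrI a)) (negPf ab).
- by case: (a + a =P k) => [->|/eqP]; rewrite ?eqxx // eq_sym => /negPf ->.
- by move=> _; rewrite -[LHS]/(_ == b) half.
Qed.

End RoundRobin.

Lemma one_factorization_transport (T T' C : finType) (mate : C -> T' -> T') c :
  #|T| = #|T'| -> one_factorization mate c ->
  exists (mate' : C -> T -> T) c', one_factorization mate' c'.
Proof.
move=> eqTT' [mateK mate_neq mateE].
pose f x := enum_val (cast_ord eqTT' (enum_rank x)).
pose g y := enum_val (cast_ord (esym eqTT') (enum_rank y)).
have fK : cancel f g by move=> x; rewrite /f /g enum_valK cast_ordK enum_rankK.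
have gK : cancel g f by move=> x; rewrite /f /g enum_valK cast_ordKV enum_rankK.
exists (fun k x => g (mate k (f x))), (fun x y => c (f x) (f y)); split.
- by move=> k x; rewrite gK mateK fK.
- by move=> k x; rewrite (can2_eq gK fK).
- by move=> k x y xy; rewrite (can2_eq gK fK) mateE // (can_eq fK).
Qed.

Lemma one_factorization_exists (T : finType) : ~~ odd #|T| -> 0 < #|T| ->
  exists (C : finType) (mate : C -> T -> T) c,
    #|C| = #|T|.-1 /\ one_factorization mate c.
Proof.
move=> evenT T_gt0; pose p := #|T|.-2; have cardT : #|T| = p.+2 by lia.
(* The cyclic group of order [#|T|.-1], which is odd, so doubling is injective. *)
pose C : finZmodType := 'I_p.+1.
have dbl_inj : injective (fun a : C => (a + a)%R).
  have dblE (a : 'I_p.+1) : (a + a) %% p.+1 = if a + a < p.+1 then a + a else a + a - p.+1.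
    case: ltnP => ha; first by rewrite modn_small.
    by rewrite -[in LHS](subnK ha) modnDr modn_small //; have := ltn_ord a; lia.
  move=> a b /(congr1 val); rewrite /= !dblE => e; apply: val_inj => /=.
  by move: (ltn_ord a) (ltn_ord b) e; do 2 case: ifP; rewrite cardT in evenT; lia.
have cardC : #|T| = #|{: option C}| by rewrite card_option card_ord.
have [mate [c fact]] :=
  one_factorization_transport cardC (robin_one_factorization dbl_inj).
by exists C, mate, c; rewrite cardT card_ord.
Qed.

(** * From a 2-(4m,4,3) design to the group divisible design *)

Section Factor.
Variables (T : finType) (f : T -> T).
Hypotheses (fK : involutive f) (f_neq : forall x, f x != x).

Definition factor_edges : {set {set T}} := [set [set x; f x] | x : T].

Lemma mem_factor_edge e x : e \in factor_edges -> (x \in e) = (e == [set x; f x]).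
Proof.
case/imsetP => y _ ->; apply/idP/eqP => [|->]; last by rewrite !inE eqxx.
by rewrite !inE => /orP[] /eqP-> //; rewrite fK setUC.
Qed.

Lemma card_factor_edge e : e \in factor_edges -> #|e| = 2.
Proof. by case/imsetP => y _ ->; rewrite cards2 eq_sym f_neq. Qed.

Lemma sum_factor_edges1 x : \sum_(e in factor_edges) (x \in e) = 1.
Proof.
rewrite (eq_bigr (fun e => e == [set x; f x] : nat)) => [|e eE].
  have eE : [set x; f x] \in factor_edges by apply: imset_f.
  by rewrite sum_eq1 eE.
by rewrite mem_factor_edge.
Qed.

Lemma sum_factor_edges2 x y : x != y ->
  \sum_(e in factor_edges) (x \in e) * (y \in e) = (f x == y).
Proof.
move=> xy; transitivity (\sum_(e in factor_edges) (x \in e) * (f x == y)).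
  apply: eq_bigr => e eE; rewrite mem_factor_edge //.
  case: eqP => // ->; by rewrite !inE [y == x]eq_sym (negPf xy) [y == _]eq_sym.
by rewrite -big_distrl /= sum_factor_edges1 mul1n.
Qed.

Lemma card_factor_edges : #|factor_edges| * 2 = #|T|.
Proof.
have -> : #|T| = \sum_(x : T) \sum_(e in factor_edges) (x \in e).
  by rewrite (eq_bigr (fun=> 1)) ?sum1_card // => x _; apply: sum_factor_edges1.
rewrite exchange_big /= (eq_bigr (fun=> 2)) ?sum_nat_const // => e eE.
by rewrite sum_mem_card card_factor_edge.
Qed.

End Factor.

(** * Unions of blocks in one group with edges in the other *)

Section TwoGroups.
Variables (T C : finType) (m : nat) (Q : seq {set T}).
Variables (mate : C -> T -> T) (c : T -> T -> C).
Hypotheses (m_gt0 : 0 < m) (cardT : #|T| = 4 * m) (cardC : #|C| = #|T|.-1).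
Hypotheses (designQ : is_BIBD 4 3 Q) (factC : one_factorization mate c).

Let X : finType := (bool * T)%type.

Definition colors : seq C := flatten (nseq m (enum C)).

Lemma sum_colors (F : C -> nat) : \sum_(k <- colors) F k = m * \sum_k F k.
Proof.
rewrite big_flatten big_nseq iter_addn_0 mulnC; congr (_ * _).
by rewrite big_enum.
Qed.

(** Each point lies in [#|T|.-1] blocks, so counting incidences gives
    [size Q * 4 = 4 * m * #|T|.-1]. Thanks to the equal lengths, [zip Q colors] drops neither a
    block nor a colour. *)
Lemma size_colors : size Q = size colors.
Proof.
have sizeC : size colors = m * #|T|.-1.
  by rewrite -sum1_size sum_colors sum1_card cardC.
have := sum_replication designQ.1.
rewrite (eq_bigr (fun=> #|T|.-1)) => [|x _].
  by rewrite sum_nat_const sizeC cardT; lia.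
by have := BIBD_replication x designQ; rewrite /=; lia.
Qed.

Definition two_group_block (b : bool) (B e : {set T}) : {set X} :=
  [set z | if z.1 == b then z.2 \in B else z.2 \in e].

(** The group [b] holds the four points of a block of [Q]; the other group holds the edge. *)
Definition half_blocks (b : bool) : seq {set X} :=
  [seq two_group_block b p.1 e | p <- zip Q colors, e <- enum (factor_edges (mate p.2))].

Definition two_group_blocks := half_blocks false ++ half_blocks true.

Definition side (b : bool) : {set X} := [set z | z.1 == b].
Definition sides : {set {set X}} := [set side b | b : bool].

Lemma sum_half_blocks b (F : {set X} -> nat) :
  \sum_(B <- half_blocks b) F B =
  \sum_(p <- zip Q colors) \sum_(e in factor_edges (mate p.2)) F (two_group_block b p.1 e).
Proof. by rewrite big_allpairs_dep; apply: eq_bigr => p _; rewrite big_enum. Qed.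

Lemma sum_zip1 (F : {set T} -> nat) :
  \sum_(p <- zip Q colors) F p.1 = \sum_(B <- Q) F B.
Proof.
by rewrite -(big_map fst xpredT) -/(unzip1 _) unzip1_zip // size_colors.
Qed.

Lemma sum_zip2 (F : C -> nat) :
  \sum_(p <- zip Q colors) F p.2 = m * \sum_k F k.
Proof.
by rewrite -(big_map snd xpredT) -/(unzip2 _) unzip2_zip ?sum_colors // size_colors.
Qed.

Lemma card_mate_edges k : #|factor_edges (mate k)| = 2 * m.
Proof.
by have [mateK mate_neq _] := factC; have := card_factor_edges (mateK k) (mate_neq k); lia.
Qed.

Lemma replicationQ x : \sum_(B <- Q) (x \in B) = #|T|.-1.
Proof. by rewrite -replicationE; have := BIBD_replication x designQ; rewrite /=; lia. Qed.

Lemma replication_half b s x :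
  replication (half_blocks b) (s, x) = (if s == b then 2 * m else m) * #|T|.-1.
Proof.
have [mateK _ _] := factC.
rewrite replicationE sum_half_blocks.
under eq_bigr => p _ do under eq_bigr => e _ do rewrite !inE /=.
case: (s == b).
  under eq_bigr => p _ do rewrite sum_nat_const card_mate_edges.
  by rewrite -big_distrr /= (sum_zip1 (fun B => x \in B : nat)) replicationQ.
under eq_bigr => p _ do rewrite sum_factor_edges1 //.
by rewrite (sum_zip2 (fun=> 1)) sum1_card cardC.
Qed.

(** In group [b], the 3 blocks through both points are each joined to [2 * m] edges. In the other
    group, the pair is an edge of exactly one factor, which is used [m] times. *)
Lemma concurrence_half_eq b s x y : x != y ->
  concurrence (half_blocks b) (s, x) (s, y) = if s == b then 6 * m else m.
Proof.
move=> xy; have [mateK _ mateE] := factC.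
rewrite concurrenceE sum_half_blocks.
under eq_bigr => p _ do under eq_bigr => e _ do rewrite !inE /=.
case: (s == b).
  under eq_bigr => p _ do rewrite sum_nat_const card_mate_edges.
  rewrite -big_distrr /= (sum_zip1 (fun B => (x \in B) * (y \in B))).
  by rewrite -concurrenceE designQ.2 //; lia.
under eq_bigr => p _ do rewrite (sum_factor_edges2 (mateK p.2)) // mateE //.
by rewrite (sum_zip2 (fun k => k == c x y)) sum_eq1 muln1.
Qed.

(** The point in group [b] lies in [#|T|.-1] blocks of [Q], and the factor attached to each of them
    covers the other point once. *)
Lemma concurrence_half_neq b s x y :
  concurrence (half_blocks b) (s, x) (~~ s, y) = #|T|.-1.
Proof.
have [mateK _ mateE] := factC.
rewrite concurrenceE sum_half_blocks.
under eq_bigr => p _ do under eq_bigr => e _ do rewrite !inE /=.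
have -> : (~~ s == b) = ~~ (s == b) by case: s; case: b.
case: (s == b) => /=.
  under eq_bigr => p _ do rewrite -big_distrr /= sum_factor_edges1 // muln1.
  by rewrite (sum_zip1 (fun B => x \in B : nat)) replicationQ.
under eq_bigr => p _ do rewrite -big_distrl /= sum_factor_edges1 // mul1n.
by rewrite (sum_zip1 (fun B => y \in B : nat)) replicationQ.
Qed.

Lemma mem_two_group_blocks B : B \in two_group_blocks ->
  exists b A e, [/\ B = two_group_block b A e, #|A| = 4 & #|e| = 2].
Proof.
have half b : B \in half_blocks b ->
    exists A e, [/\ B = two_group_block b A e, #|A| = 4 & #|e| = 2].
  case/allpairsPdep => [[A k] [e [Ak eE ->]]]; exists A, e; split=> //.
    apply: designQ.1; move: (map_f fst Ak); rewrite -/(unzip1 _) unzip1_zip //.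
    by rewrite size_colors.
  have [mateK mate_neq _] := factC.
  by apply: (@card_factor_edge _ (mate k)) => //; move: eE; rewrite mem_enum.
by rewrite mem_cat => /orP[] /half [A [e ?]]; [exists false | exists true]; exists A, e.
Qed.

Lemma card_pair_set s (A : {set T}) : #|[set z : X | (z.1 == s) && (z.2 \in A)]| = #|A|.
Proof.
have <- : [set (s, x) | x in A] = [set z : X | (z.1 == s) && (z.2 \in A)].
  apply/setP => -[t x]; rewrite !inE /=; apply/imsetP/andP => [[y yA [-> ->]]//|].
  by case=> /eqP-> xA; exists x.
by rewrite card_imset // => x y [].
Qed.

Lemma two_group_block_side b A e :
  #|two_group_block b A e :&: side b| = #|A| /\
  #|two_group_block b A e :&: side (~~ b)| = #|e|.
Proof.
split; [rewrite -(card_pair_set b) | rewrite -(card_pair_set (~~ b))];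
  apply: eq_card => -[t x]; rewrite !inE /= andbC.
- by case: (t == b).
- by case: t; case: b; rewrite ?andbF.
Qed.

Lemma side_inj : injective side.
Proof.
case: (pickP T) => [x _ s t /setP /(_ (s, x))|T0]; first by rewrite !inE eqxx => /esym/eqP.
by move: cardT; rewrite eq_card0 // => /esym; lia.
Qed.

Lemma two_groups_GDD :
  is_GDD (4 * m) 2 6 (7 * m) (2 * (4 * m - 1)) sides two_group_blocks.
Proof.
split.
- by rewrite card_prod card_bool cardT.
- apply/and3P; split.
  + apply/eqP/setP => -[s x]; rewrite inE; apply/bigcupP; exists (side s); last by rewrite inE.
    exact: imset_f.
  + apply/trivIsetP => _ _ /imsetP[s _ ->] /imsetP[t _ ->] st.
    rewrite disjoint_subset; apply/subsetP => z; rewrite !inE => /eqP->.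
    by apply: contra st => /eqP->.
  + apply/imsetP => -[s _ /setP s0].
    case: (pickP T) => [x _|T0]; first by have := s0 (s, x); rewrite !inE eqxx.
    by move: cardT; rewrite eq_card0 // => /esym; lia.
- by rewrite card_imset ?card_bool //; apply: side_inj.
- move=> _ /imsetP[s _ ->]; rewrite -cardT -cardsT -(card_pair_set s).
  by apply: eq_card => z; rewrite !inE andbT.
- move=> B /mem_two_group_blocks [b [A [e [-> cardA carde]]]].
  have [eqA eqe] := two_group_block_side b A e.
  rewrite -(cardsID (side b)) eqA -[RHS]/(4 + 2) -cardA -carde -eqe; congr (_ + _).
  by apply: eq_card => -[t x]; rewrite !inE /= andbC; move: (b) t => [] [].
(* The two halves contribute [2 * m] and [m] times [#|T|.-1]. *)
- exists (3 * m * #|T|.-1) => -[s x].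
  rewrite /replication count_cat -!/(replication _ _) !replication_half.
  by case: s => /=; lia.
- move=> _ [s x] [t y] /imsetP[b _ ->]; rewrite !inE /= => /eqP-> /eqP-> bxy.
  have xy : x != y by apply: contra bxy => /eqP->.
  rewrite /concurrence count_cat -!/(concurrence _ _ _) !concurrence_half_eq //.
  by case: b {bxy} => /=; lia.
- move=> _ _ [s x] [t y] /imsetP[b _ ->] /imsetP[d _ ->] bd.
  rewrite !inE /= => /eqP-> /eqP->.
  have -> : d = ~~ b by move: bd; case: b; case: d; rewrite ?eqxx.
  by rewrite /concurrence count_cat -!/(concurrence _ _ _) !concurrence_half_neq; lia.
Qed.

Lemma two_groups_configuration : has_configuration 2 4 sides two_group_blocks.
Proof.
move=> B /mem_two_group_blocks [b [A [e [-> cardA carde]]]].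
have [eqA eqe] := two_group_block_side b A e.
exists (side (~~ b)), (side b); split; rewrite ?imset_f ?eqA ?eqe //.
by rewrite (inj_eq side_inj); case: b {eqA eqe}.
Qed.

End TwoGroups.

(** * Designs on V x L *)

(** The first bit is the sign of the offset, the second tells whether [phi] is applied. *)
Definition position := (bool * bool)%type.
Definition positions : seq position :=
  [:: (false, false); (true, false); (false, true); (true, true)].
Definition opp_pos (i : position) : position := (~~ i.1, i.2).

Lemma mem_positions i : i \in positions.
Proof. by case: i => [[] []]. Qed.

(* A word lists the levels of the offsets d, -d, phi d, -phi d, in this order. *)
Definition letter (w : seq nat) (i : position) : nat := nth 0 w (i.1 + i.2.*2).
Definition swap_word (w : seq nat) : seq nat := [seq letter w (opp_pos i) | i <- positions].

Definition pair_count (w : seq nat) (f g : nat) (i j : position) : nat :=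
  (letter w i == f) * (letter w j == g).

(** The total 6 is twice the index 3, because [d] runs only through half of the nonzero elements;
    closure under [swap_word] makes up for the other half. The case [f = g] concerns points of equal
    level in different fibres. Lists of naturals keep the test computable. *)
Definition balanced_words (l : nat) (W : seq (seq nat)) : bool :=
  [&& all (fun w => (size w == 4) && all (fun f => f < l) w) W,
      perm_eq (map swap_word W) W &
      all (fun f => all (fun g =>
        sumn [seq sumn [seq sumn [seq (if i == j then 0 else pair_count w f g i j) | w <- W]
              | j <- positions] | i <- positions] == 6) (iota 0 l)) (iota 0 l)].

(** * Offsets whose pairwise differences are bijective in [d] *)

Section Spread.
Import GRing.Theory.
Local Open Scope ring_scope.

(** Up to sign, the four injective maps are all the differences of two distinct entries of
    [d, - d, phi d, - phi d]. *)
Definition spread (V : finZmodType) (phi : V -> V) : Prop :=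
  [/\ {morph phi : x / - x}, injective (fun x : V => x + x),
      injective (fun x => phi x + phi x),
      injective (fun x => phi x + x) & injective (fun x => phi x - x)].

Variables (V : finZmodType) (phi : V -> V).
Hypothesis spread_phi : spread phi.

Definition offset (i : position) (d : V) : V :=
  let e := if i.2 then phi d else d in if i.1 then - e else e.

Lemma offset_opp i d : offset (opp_pos i) d = - offset i d.
Proof. by case: i => [[] b]; rewrite /offset //= opprK. Qed.

Lemma offsetN i d : offset i (- d) = - offset i d.
Proof. by have [phiN _ _ _ _] := spread_phi; case: i => [[] []]; rewrite /offset /= ?phiN. Qed.

Lemma offset_sub_inj i j : i != j -> injective (fun d => offset i d - offset j d).
Proof.
have [phiN i2 ip2 ipD ipB] := spread_phi.
have neg (g h : V -> V) : injective g -> (forall d, h d = - g d) -> injective h.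
  by move=> ig e x y; rewrite !e => /oppr_inj /ig.
case: i j => [[] []] [[] []] //= _; rewrite /offset /=.
- by apply: (neg _ _ ipB) => d; rewrite opprB opprK addrC.
- by apply: (neg _ _ ip2) => d; rewrite opprD.
- by apply: (neg _ _ ipD) => d; rewrite opprD.
- by apply: eq_inj ipB _ => d; rewrite opprK addrC.
- by apply: (neg _ _ ipD) => d; rewrite opprD addrC.
- by apply: (neg _ _ i2) => d; rewrite opprD.
- by apply: eq_inj ip2 _ => d; rewrite opprK.
- by apply: eq_inj ipD _ => d; rewrite opprK.
- by apply: eq_inj ipD _ => d; rewrite opprK addrC.
- by apply: eq_inj i2 _ => d; rewrite opprK.
- by apply: (neg _ _ ipB) => d; rewrite opprB.
Qed.

Lemma offset0 i : offset i 0 = 0.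
Proof.
have [phiN i2 _ _ _] := spread_phi.
have phi0 : phi 0 = 0.
  by apply: i2; rewrite -{2}[0]oppr0 phiN subrr addr0.
by case: i => [[] []]; rewrite /offset /= ?phi0 ?oppr0.
Qed.

Lemma offset_neq i j d : i != j -> d != 0 -> offset i d != offset j d.
Proof.
move=> ij; apply: contra => /eqP e; apply/eqP/(offset_sub_inj ij).
by rewrite e !offset0 !subrr.
Qed.

(* Selects exactly one element of each pair {d, -d} with d != 0. *)
Definition positive (d : V) : bool := (enum_rank d < enum_rank (- d))%N.

Lemma positive_neq0 d : positive d -> d != 0.
Proof. by apply: contraTneq => ->; rewrite /positive oppr0 ltnn. Qed.

Lemma positiveN d : (positive d + positive (- d)%R)%N = (d != 0) :> nat.
Proof.
have [_ i2 _ _ _] := spread_phi.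
rewrite /positive opprK; case: (eqVneq d 0) => [->|d0]; first by rewrite oppr0 ltnn.
have : enum_rank d != enum_rank (- d).
  rewrite (inj_eq enum_rank_inj); apply: contra d0 => /eqP e.
  by apply/eqP/i2; rewrite {2}e subrr addr0.
by rewrite neq_ltn => /orP[h|h]; rewrite h ltnNge (ltnW h).
Qed.

Definition hits i j (delta : V) : nat :=
  (\sum_(d | positive d) (offset i d - offset j d == delta)%R)%N.

(** Negating both positions amounts to replacing [d] by [- d], so the two half sums add up to a sum
    over all of [V], where the bijection [g] takes the value [delta] once. That happens at a nonzero
    [d], since [g 0 = 0]. *)
Lemma hits_opp i j delta : i != j -> delta != 0 ->
  (hits i j delta + hits (opp_pos i) (opp_pos j) delta = 1)%N.
Proof.
move=> ij delta0; pose g d := offset i d - offset j d.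
have -> : hits (opp_pos i) (opp_pos j) delta = (\sum_(d | positive (- d)%R) (g d == delta))%N.
  rewrite [RHS](reindex_inj (@oppr_inj V)) /=; apply: eq_big => [d|d _]; first by rewrite opprK.
  by rewrite !offset_opp /g !offsetN.
have -> : 1%N = (\sum_d (g d == delta))%N.
  apply/esym; rewrite -[RHS](sum_eq1 (invF (offset_sub_inj ij) delta) predT).
  apply: eq_bigr => d _.
  have E := can2_eq (invF_f (offset_sub_inj ij)) (f_invF (offset_sub_inj ij)) d delta.
  by rewrite -E.
rewrite /hits !(big_mkcond (fun d => positive _)) -big_split /=; apply: eq_bigr => d _.
have := positiveN d; case: (eqVneq (g d) delta) => [gd|_]; last by do 2 case: ifP.
suff -> : d != 0 by case: (positive d); case: (positive (- d)).
by apply: contraNneq delta0 => d0; rewrite -gd d0 /g !offset0 subrr.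
Qed.

Lemma hits_same i delta : delta != 0 -> hits i i delta = 0%N.
Proof.
by move=> delta0; rewrite /hits big1 // => d _; rewrite subrr eq_sym (negPf delta0).
Qed.

End Spread.

(** * The design formed by fibre blocks and word blocks *)

Section Blowup.
Import GRing.Theory.
Variables (V : finZmodType) (phi : V -> V) (l : nat).
Variables (Q : seq {set 'I_l}) (W : seq (seq nat)).
Hypotheses (spread_phi : spread phi) (designQ : is_BIBD 4 3 Q) (balW : balanced_words l W).

Let T : finType := (V * 'I_l)%type.

Definition at_position (x d : V) (w : seq nat) (p : T) (i : position) : bool :=
  (p.1 == (x + offset phi i d)%R) && (val p.2 == letter w i).

Definition word_block (x d : V) (w : seq nat) : {set T} :=
  [set p | has (at_position x d w p) positions].

Definition fibre_block (v : V) (B : {set 'I_l}) : {set T} :=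
  [set p | (p.1 == v) && (p.2 \in B)].

Definition fibre_blocks : seq {set T} := [seq fibre_block v B | v <- enum V, B <- Q].

Definition word_blocks : seq {set T} :=
  [seq word_block xd.1 xd.2 w |
     xd <- [seq (x, d) | x <- enum V, d <- enum (positive (V := V))], w <- W].

Definition blowup : seq {set T} := fibre_blocks ++ word_blocks.

(** For [d != 0] the four offsets are distinct, so a point matches at most one position and the
    indicator is a sum. *)
Lemma mem_word_block x d w p : d != 0%R ->
  (p \in word_block x d w : nat) = \sum_(i <- positions) at_position x d w p i.
Proof.
move=> d0; rewrite inE; case: hasP => [[i _ pi]|no]; last first.
  rewrite big1 // => i _; apply/eqP; rewrite eqb0.
  by apply: contra_notN no => pi; exists i; rewrite ?mem_positions.
rewrite (bigD1_seq i) ?mem_positions //= pi big1 // => j ji.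
apply/eqP; rewrite eqb0; apply/negP => pj.
move: pi pj => /andP[/eqP pi _] /andP[/eqP].
rewrite pi => /addrI /eqP e _; move: e; apply/negP.
by apply: (offset_neq spread_phi) => //; rewrite eq_sym.
Qed.

Lemma letter_lt w i : w \in W -> letter w i < l.
Proof.
have /and3P[/allP Wl _ _] := balW => /Wl /andP[/eqP sw /allP wl].
by apply: wl; rewrite mem_nth // sw; case: i => [[] []].
Qed.

Lemma card_word_block x d w : d != 0%R -> w \in W -> #|word_block x d w| = 4.
Proof.
move=> d0 wW; rewrite -sum_mem_card.
under eq_bigr do rewrite mem_word_block //.
rewrite exchange_big /= (eq_bigr (fun=> 1)) => [|i _].
  by rewrite sum1_size.
rewrite -[RHS](sum_eq1 ((x + offset phi i d)%R, Ordinal (letter_lt i wW)) predT).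
by apply: eq_bigr => -[u f] _; rewrite -pair_eqE.
Qed.

Lemma card_fibre_block v (B : {set 'I_l}) : #|fibre_block v B| = #|B|.
Proof.
have <- : [set (v, f) | f in B] = fibre_block v B.
  apply/setP => -[u f]; rewrite !inE /=; apply/imsetP/andP => [[g gB [-> ->]]//|].
  by case=> /eqP-> fB; exists f.
by rewrite card_imset // => f g [].
Qed.

Lemma concurrence_fibres u v f g : (u, f) != (v, g) :> T ->
  concurrence fibre_blocks (u, f) (v, g) = if u == v then 3 else 0.
Proof.
move=> pq; rewrite concurrenceE big_allpairs_dep big_enum /=.
transitivity (\sum_(x : V) (x == u) * (x == v) * \sum_(B <- Q) (f \in B) * (g \in B)).
  apply: eq_bigr => x _; rewrite big_distrr; apply: eq_bigr => B _.
  rewrite !inE /= ![_ == x]eq_sym.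
  by case: (x == u); case: (x == v); rewrite /= ?mul1n ?mul0n ?muln0.
rewrite -big_distrl /= -concurrenceE.
case: (eqVneq u v) => [uv|uv].
  rewrite designQ.2; last by apply: contra pq => /eqP->; rewrite uv.
  rewrite (eq_bigr (fun x => x == v : nat)) => [|x _]; first by rewrite sum_eq1.
  by rewrite uv mulnb andbb.
rewrite big1 // => x _; rewrite mulnb; case: eqP => // ->.
by rewrite (negPf uv).
Qed.

Lemma concurrence_words_same u f g : f != g ->
  concurrence word_blocks (u, f) (u, g) = 0.
Proof.
move=> fg; apply/eqP; rewrite -leqn0 leqNgt -has_count; apply/hasPn => B.
case/allpairsP => -[[x d] w] [/= /allpairsP[[x' d'] [_ /= dpos [-> ->]]] _ ->].
rewrite mem_enum in dpos; have d0 := positive_neq0 dpos.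
apply/negP; rewrite !inE => /andP[/hasP [i _ /andP [/eqP ei /eqP fi]]].
case/hasP => j _ /andP [/eqP ej /eqP gj]; rewrite /= in ei ej fi gj.
have ij : i = j.
  apply/eqP; case: (eqVneq i j) => // /(offset_neq spread_phi) /(_ d0) /negP[].
  by apply/eqP/(addrI x'); rewrite -ei -ej.
by move: fg; rewrite -val_eqE /= fi gj ij eqxx.
Qed.

(** Once the positions and [d] are fixed, [u] determines the translation [x], and what remains is
    that the offsets differ by [u - v]. *)
Lemma concurrence_words_hits u v f g :
  concurrence word_blocks (u, f) (v, g) =
  \sum_(i <- positions) \sum_(j <- positions)
     (\sum_(w <- W) pair_count w f g i j) * hits phi i j (u - v)%R.
Proof.
rewrite concurrenceE !big_allpairs_dep big_enum /=.
transitivity (\sum_(x : V) \sum_(d | positive d) \sum_(w <- W)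
  \sum_(i <- positions) \sum_(j <- positions)
    pair_count w f g i j * ((u == x + offset phi i d)%R * (v == x + offset phi j d)%R)).
  apply: eq_bigr => x _; rewrite big_enum; apply: eq_bigr => d dpos.
  apply: eq_bigr => w _; rewrite !mem_word_block ?(positive_neq0 dpos) //.
  rewrite big_distrl; apply: eq_bigr => i _; rewrite big_distrr; apply: eq_bigr => j _.
  by rewrite /at_position /pair_count /= -!mulnb ![letter w _ == _]eq_sym mulnACA mulnC.
rewrite pair_big_dep /= exchange_big.
under eq_bigr do (rewrite exchange_big; under eq_bigr do rewrite exchange_big).
rewrite exchange_big; apply: eq_bigr => i _; rewrite exchange_big; apply: eq_bigr => j _.
rewrite big_distrl; apply: eq_bigr => w _; rewrite -big_distrr /=; congr (_ * _).
rewrite -(pair_big_dep xpredT (fun _ d => positive d)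
  (fun x d => (u == x + offset phi i d)%R * (v == x + offset phi j d)%R)) exchange_big.
apply: eq_bigr => d _.
transitivity (\sum_(x : V)
  (x == u - offset phi i d)%R * (offset phi i d - offset phi j d == u - v)%R).
  apply: eq_bigr => x _; rewrite -subr_eq eq_sym; case: eqP => // ->.
  rewrite -subr_eq ![_ == (u - _)%R]eq_sym !subr_eq.
  by congr (1 * (_ == _)); rewrite addrC addrCA addrC.
by rewrite -big_distrl /= sum_eq1 mul1n.
Qed.

Lemma sum_positions_opp (F : position -> nat) :
  \sum_(i <- positions) F (opp_pos i) = \sum_(i <- positions) F i.
Proof. by rewrite -(big_map opp_pos xpredT); apply: perm_big. Qed.

Lemma pair_count_swap f g i j :
  \sum_(w <- W) pair_count w f g (opp_pos i) (opp_pos j) =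
  \sum_(w <- W) pair_count w f g i j.
Proof.
have /and3P[_ swapW _] := balW.
rewrite -(perm_big _ swapW) big_map; apply: eq_bigr => w _.
by case: i j => [[] []] [[] []].
Qed.

Lemma sum_pair_count (f g : 'I_l) :
  \sum_(i <- positions) \sum_(j <- positions)
    (if i == j then 0 else \sum_(w <- W) pair_count w f g i j) = 6.
Proof.
have /and3P[_ _ /allP/(_ (f : nat))] := balW; rewrite mem_iota ltn_ord => /(_ isT).
move=> /allP/(_ (g : nat)); rewrite mem_iota ltn_ord => /(_ isT)/eqP <-.
rewrite sumnE big_map; apply: eq_bigr => i _; rewrite sumnE big_map; apply: eq_bigr => j _.
by rewrite sumnE big_map; case: (i == j) => //; rewrite big1.
Qed.

(** The count is added to itself with all positions negated. The word counts do not change, the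
    [hits] of opposite position pairs add up to 1, and the balance condition leaves 6. *)
Lemma concurrence_words u v f g : u != v -> concurrence word_blocks (u, f) (v, g) = 3.
Proof.
move=> uv; have delta0 : (u - v)%R != 0%R by rewrite subr_eq0.
suff : concurrence word_blocks (u, f) (v, g) * 2 = 6 by lia.
rewrite -(sum_pair_count f g) muln2 -addnn.
rewrite concurrence_words_hits -[X in _ + X]sum_positions_opp -big_split.
apply: eq_bigr => i _; rewrite /= -[X in _ + X]sum_positions_opp -big_split.
apply: eq_bigr => j _; rewrite /= pair_count_swap -mulnDr; case: eqVneq => [->|ij].
  by rewrite !hits_same ?muln0.
by rewrite hits_opp // muln1.
Qed.

Lemma blowup_BIBD : is_BIBD 4 3 blowup.
Proof.
split=> [B|[u f] [v g] pq].
  rewrite mem_cat => /orP[/allpairsP[[v A] [/= _ AQ ->]]|].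
    by rewrite card_fibre_block designQ.1.
  case/allpairsP => -[[x d] w] [/= /allpairsP[[x' d'] [_ /= dpos [_ ->]]] wW ->].
  by apply: card_word_block => //; rewrite mem_enum in dpos; apply: positive_neq0.
rewrite /concurrence count_cat -!/(concurrence _ _ _) concurrence_fibres //.
case: (eqVneq u v) => [uv|uv]; last exact: concurrence_words.
rewrite uv concurrence_words_same //.
by apply: contra pq => /eqP->; rewrite uv.
Qed.

End Blowup.

(** * Groups with a spread map *)

(* The library has both structures on products, but not their join. *)
HB.instance Definition _ (U V : finZmodType) := Finite.on (U * V)%type.

Section SpreadGroups.
Import GRing.Theory.
Local Open Scope ring_scope.

(** The order of an element killed by [k] divides both [k] and [#|V|]. *)
Lemma coprime_mulrn_inj (V : finZmodType) k :
  coprime k #|V| -> injective (fun x : V => x *+ k).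
Proof.
move=> cokV x y /eqP; rewrite -subr_eq0 -mulrnBl => xyk.
apply/eqP; rewrite -subr_eq0 -FinRing.zmod1gE -order_eq1 -dvdn1 -(eqP cokV) dvdn_gcd.
by rewrite order_dvdn FinRing.zmodXgE FinRing.zmod1gE xyk -cardsT order_dvdG ?inE.
Qed.

Lemma additive_inj (U V : zmodType) (g : U -> V) :
  {morph g : x y / x - y} -> (forall x, g x = 0 -> x = 0) -> injective g.
Proof.
move=> gB g0 x y exy; apply/eqP; rewrite -subr_eq0; apply/eqP/g0.
by rewrite gB exy subrr.
Qed.

Lemma spread_additive (V : finZmodType) (phi : V -> V) :
  odd #|V| -> {morph phi : x y / x - y} ->
  (forall x, phi x = 0 -> x = 0) -> (forall x, phi x + x = 0 -> x = 0) ->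
  (forall x, phi x - x = 0 -> x = 0) -> spread phi.
Proof.
move=> oddV phiB phi0 phiD0 phiB0.
have dbl : injective (fun x : V => x + x).
  by apply: (@coprime_mulrn_inj _ 2); rewrite coprime2n.
have phiI := additive_inj phiB phi0.
split=> //.
- move=> x; have phi00 : phi 0 = 0 by rewrite -[0 in LHS](subrr 0) phiB subrr.
  by rewrite -sub0r phiB phi00 sub0r.
- by move=> x y /dbl /phiI.
- by apply: additive_inj phiD0 => x y; rewrite phiB opprD addrACA.
- by apply: additive_inj phiB0 => x y; rewrite phiB !opprD addrACA.
Qed.

(** With [phi] multiplication by 2, the maps [phi + 1] and [phi - 1] are multiplication by 3 and by
    1. *)
Lemma spread_double (V : finZmodType) :
  coprime 6%N #|V| -> spread (fun x : V => x + x).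
Proof.
rewrite -[6%N]/(2 * 3)%N coprimeMl coprime2n => /andP[oddV co3].
have dbl0 (x : V) : x + x = 0 -> x = 0.
  by move=> x0; apply: (@coprime_mulrn_inj _ 2); rewrite ?coprime2n //= mul0rn.
apply: spread_additive => //.
- by move=> x y; rewrite opprD addrACA.
- move=> x x0; apply: (coprime_mulrn_inj co3); rewrite /= mul0rn -[RHS]x0.
  by rewrite mulrSr mulr2n.
- by move=> x; rewrite addrK.
Qed.

(** Multiplication by [i] on [V[i]] with [i^2 = -1]; the product of [1 + i] and [1 - i] is 2, which
    acts injectively in odd order. *)
Lemma spread_square (V : finZmodType) :
  odd #|V| -> @spread (V * V)%type (fun v => (- v.2, v.1)).
Proof.
move=> oddV.
have dbl0 (x : V) : x + x = 0 -> x = 0.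
  by move=> x0; apply: (@coprime_mulrn_inj _ 2); rewrite ?coprime2n //= mul0rn.
apply: spread_additive => [|[x y] [z t]|[x y] [/eqP]|[x y] [e1 e2]|[x y] [e1 e2]] //=.
- by rewrite card_prod oddM oddV.
- by rewrite opprD.
- by rewrite oppr_eq0 => /eqP-> ->.
- have exy : x = y by apply/eqP; rewrite -subr_eq0 addrC e1.
  by move: e2; rewrite exy => /dbl0 ->.
- have exy : x = y by apply/eqP; rewrite -subr_eq0 e2.
  move: e1; rewrite exy -opprD => /eqP; rewrite oppr_eq0 => /eqP/dbl0 -> //.
Qed.

(* Multiplication by t on V[t]/(t^3 - t - 1), in which t, t - 1 and
   t + 1 are units over any V. *)
Lemma spread_cube (V : finZmodType) :
  odd #|V| -> @spread (V * (V * V))%type (fun v => (v.2.2, (v.1 + v.2.2, v.2.1))).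
Proof.
move=> oddV.
apply: spread_additive => [|[x [y z]] [x' [y' z']]|[x [y z]] []|[x [y z]] []|[x [y z]] []] //=.
- by rewrite !card_prod !oddM oddV.
- by rewrite addrACA -opprD.
- by move=> -> xz ->; rewrite addr0 in xz; rewrite xz.
- move=> zx; rewrite [x + z]addrC zx add0r => y0.
  by rewrite y0 add0r => z0; move: zx; rewrite z0 add0r => ->.
- move=> /eqP; rewrite subr_eq0 => /eqP zx + /eqP; rewrite subr_eq0 => + /eqP yz.
  by rewrite yz addrK -zx => ->.
Qed.

Lemma spread_prod (U V : finZmodType) (phi : U -> U) (psi : V -> V) :
  spread phi -> spread psi -> @spread (U * V)%type (fun v => (phi v.1, psi v.2)).
Proof.
move=> [phiN i1 i2 i3 i4] [psiN j1 j2 j3 j4].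
split=> [[x y]|[x y] [z t] [] /i1-> /j1->|[x y] [z t] [] /i2-> /j2->|
         [x y] [z t] [] /i3-> /j3->|[x y] [z t] [] /i4-> /j4->] //.
by rewrite /= phiN psiN.
Qed.

End SpreadGroups.

Definition spread_order (m : nat) : Prop :=
  exists (V : finZmodType) (phi : V -> V), spread phi /\ #|V| = m.

Lemma spread_order_mul a b : spread_order a -> spread_order b -> spread_order (a * b).
Proof.
move=> [U [phi [sphi <-]]] [V [psi [spsi <-]]].
exists (U * V)%type; exists (fun v => (phi v.1, psi v.2)).
by split; [exact: spread_prod | rewrite card_prod].
Qed.

Lemma spread_order_coprime6 m : coprime 6 m -> spread_order m.
Proof.
case: m => // m co6; exists 'I_m.+1; exists (fun x => (x + x)%R).
by split; [apply: spread_double; rewrite card_ord | rewrite card_ord].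
Qed.

Lemma spread_order_pow3 k : 2 <= k -> spread_order (3 ^ k).
Proof.
have card3 : #|'I_3| = 3 by rewrite card_ord.
have odd3 : odd #|'I_3| by rewrite card3.
elim/ltn_ind: k => -[|[|[|[|k]]]] IH // _.
- exists ('I_3 * 'I_3)%type; exists (fun v => (- v.2, v.1)%R).
  by split; [exact: spread_square | rewrite card_prod card3].
- exists ('I_3 * ('I_3 * 'I_3))%type; exists (fun v => (v.2.2, (v.1 + v.2.2, v.2.1))%R).
  by split; [exact: spread_cube | rewrite !card_prod card3].
(* Exponents from 4 on are reduced by 2, down to the base cases 2 and 3. *)
- by rewrite -[k.+4]/(2 + k.+2) expnD; apply: spread_order_mul; apply: IH; lia.
Qed.

(** The 3-part, with exponent 0 or at least 2, and the cofactor prime to 6 are handled separately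
    and multiplied. *)
Lemma spread_order_odd m : odd m -> logn 3 m != 1 -> spread_order m.
Proof.
move=> oddm log1; have m_gt0 : 0 < m by case: m oddm {log1}.
have co6 : coprime 6 m`_3^'.
  rewrite -[6]/(2 * 3) coprimeMl coprime2n (dvdn_odd (dvdn_part _ _) oddm).
  exact: (pnat_coprime (pnat_id (isT : prime 3)) (part_pnat _ _)).
rewrite -(partnC 3 m_gt0); apply: spread_order_mul; last exact: spread_order_coprime6.
rewrite p_part; case: (logn 3 m) log1 => [|[|k]] // _.
  exact: spread_order_coprime6.
exact: spread_order_pow3.
Qed.

(** * Designs with 4 and 12 points *)

(** An edge word counts 4 for its pair of levels in either order, and 2 for each endpoint with
    itself; a quadruple of distinct levels and its swap together count 2 for each of its pairs.
    Balance thus means a 3-regular graph whose edges lie in one quadruple each and whose non-edges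
    lie in three. *)
Definition closed_words (edges : seq (nat * nat)) (quads : seq (seq nat)) : seq (seq nat) :=
  [seq [:: e.1; e.1; e.2; e.2] | e <- edges] ++ quads ++ map swap_word quads.

Definition words4 : seq (seq nat) :=
  closed_words [:: (0, 1); (0, 2); (0, 3); (1, 2); (1, 3); (2, 3)] [:: [:: 0; 1; 2; 3]].

Lemma balanced_words4 : balanced_words 4 words4.
Proof. by vm_compute. Qed.

Lemma BIBD4 : is_BIBD 4 3 (nseq 3 [set: 'I_4]).
Proof.
split=> [B|x y _]; first by rewrite mem_nseq => /andP[_ /eqP->]; rewrite cardsT card_ord.
by rewrite /concurrence /= !inE.
Qed.

(* Found by computer search.  Both lists are developed modulo 3 in each of the
   classes {0,1,2}, {3,4,5}, {6,7,8}, {9,10,11}; the edges are those of two prisms. *)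
Definition shift3 (s p : nat) : nat := p %/ 3 * 3 + (p + s) %% 3.

Definition words12 : seq (seq nat) :=
  closed_words
    [seq (shift3 s e.1, shift3 s e.2) | s <- iota 0 3,
       e <- [:: (0, 1); (3, 4); (6, 7); (9, 10); (0, 3); (6, 9)]]
    [seq map (shift3 s) q | s <- iota 0 3,
       q <- [:: [:: 1; 3; 11; 6]; [:: 7; 9; 5; 3]; [:: 9; 0; 7; 5]; [:: 11; 2; 8; 5];
                [:: 11; 7; 1; 0]; [:: 11; 7; 2; 3]; [:: 5; 9; 8; 1]; [:: 4; 0; 6; 8];
                [:: 2; 4; 10; 9]]].

Lemma balanced_words12 : balanced_words 12 words12.
Proof. by vm_compute. Qed.

(* Developed modulo 11, with 11 as the fixed point. *)
Definition quads12 : seq (seq nat) :=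
  [seq [seq if p == 11 then 11 else (p + s) %% 11 | p <- q] | s <- iota 0 11,
     q <- [:: [:: 11; 0; 1; 2]; [:: 0; 1; 4; 7]; [:: 0; 2; 5; 7]]].

Definition set_of_list (l : nat) (q : seq nat) : {set 'I_l} := [set f | val f \in q].

Definition sets_of_lists (l : nat) (D : seq (seq nat)) : seq {set 'I_l} :=
  map (set_of_list l) D.

Lemma card_set_of_list (l : nat) (q : seq nat) : uniq q -> all (fun f => f < l) q ->
  #|set_of_list l q| = size q.
Proof.
move=> uq /allP ql; rewrite cardE -(size_map val); apply: perm_size.
apply: uniq_perm => // [|f]; first by rewrite map_inj_uniq ?enum_uniq //; apply: val_inj.
apply/mapP/idP => [[x]|fq]; first by rewrite mem_enum inE => + ->.
by exists (Ordinal (ql _ fq)); rewrite ?mem_enum ?inE.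
Qed.

Lemma BIBD12 : is_BIBD 4 3 (sets_of_lists 12 quads12).
Proof.
split=> [B /mapP[q qD ->]|x y xy].
  have /allP/(_ q qD)/and3P[uq ql /eqP sizeq] :
    all (fun q => [&& uniq q, all (fun f => f < 12) q & size q == 4]) quads12 by vm_compute.
  by rewrite card_set_of_list.
rewrite /concurrence count_map.
rewrite (eq_count (a2 := fun q => (val x \in q) && (val y \in q))) => [|q]; last by rewrite /= !inE.
(* The pair counts are evaluated on natural numbers and then read back in ['I_12]. *)
have : all (fun f => all (fun g => (f == g) ||
   (count (fun q : seq nat => (f \in q) && (g \in q)) quads12 == 3)) (iota 0 12)) (iota 0 12).
  by vm_compute.
move=> /allP/(_ (val x)); rewrite mem_iota ltn_ord => /(_ isT).
move=> /allP/(_ (val y)); rewrite mem_iota ltn_ord => /(_ isT).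
by rewrite val_eqE (negPf xy) => /eqP.
Qed.

Lemma BIBD_4_3_exists (m : nat) : odd m ->
  exists (T : finType) (Q : seq {set T}), #|T| = 4 * m /\ is_BIBD 4 3 Q.
Proof.
move=> oddm; case: (eqVneq (logn 3 m) 1) => log1; last first.
  have [V [phi [sphi <-]]] := spread_order_odd oddm log1.
  exists (V * 'I_4)%type; exists (blowup phi (nseq 3 [set: 'I_4]) words4); split.
    by rewrite card_prod card_ord mulnC.
  exact: blowup_BIBD sphi BIBD4 balanced_words4.
have m_gt0 : 0 < m by case: m oddm {log1}.
(* Here [m'] is odd and prime to 3, hence a spread order, and [4 * m = m' * 12]. *)
have [m' mE] : exists m', m = m' * 3.
  by apply/dvdnP; rewrite -[3]expn1 pfactor_dvdn // log1.
have [V [phi [sphi cardV]]] : spread_order m'.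
  move: log1 oddm m_gt0; rewrite mE => log1 oddm m_gt0; apply: spread_order_odd.
    by move: oddm; rewrite oddM => /andP[].
  move: log1; rewrite lognM //; last by lia.
  by rewrite -[X in _ + X]/1; lia.
exists (V * 'I_12)%type; exists (blowup phi (sets_of_lists 12 quads12) words12); split.
  by rewrite card_prod card_ord cardV mE; lia.
exact: blowup_BIBD sphi BIBD12 balanced_words12.
Qed.

Theorem corollary5p3 (n : nat) (n_gt0 : 0 < n)
    (n_mod : n %% 56 \in [:: 4; 12; 20; 28; 44; 52]) :
  exists (X : finType) (groups : {set {set X}}) (blocks : seq {set X}),
    is_GDD n 2 6 ((7 * n) %/ 4) (2 * (n - 1)) groups blocks /\
    has_configuration 2 4 groups blocks.
Proof.
(* All the listed residues are 4 modulo 8. *)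
have [m [nE oddm]] : exists m, n = 4 * m /\ odd m.
  exists (n %/ 4); move: n_mod; rewrite !inE; lia.
have m_gt0 : 0 < m by case: m oddm {nE}.
have [T [Q [cardT designQ]]] := BIBD_4_3_exists oddm.
have [C [mate [c [cardC factC]]]] : exists (C : finType) (mate : C -> T -> T) c,
    #|C| = #|T|.-1 /\ one_factorization mate c.
  by apply: one_factorization_exists; rewrite cardT ?oddM //; lia.
exists (bool * T)%type, (sides T), (two_group_blocks m Q mate); split; last first.
  exact: two_groups_configuration cardC designQ factC.
rewrite nE mulnCA mulKn //.
exact: two_groups_GDD cardC designQ factC.
Qed.
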